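(* Let $\mathfrak{F}=\langle W,R\rangle$ be a bounded graph. Then for every $n\in\omega$ and every non-principal ultrafilter $u$ over $W$, \[\{w\in W:\langle w\rangle^n\cong\langle u\rangle^n\}\in u,\] where $\langle w\rangle^n$ is the $n$-Hull of $w$ in $\mathfrak{F}$ and $\langle u\rangle^n$ is the $n$-Hull of $u$ in $\mathfrak{F}^{\mathfrak{ue}}$.
   Context: A directed graph $\mathfrak{F}=\langle W,R\rangle$ is bounded if there is $m\in\omega$ with $|\{s:Rws\}|+|\{s:Rsw\}|\leq m$ for all $w\in W$. For $X\subseteq W$, $R^-(X)=\{w:\exists s\,(Rws\wedge s\in X)\}$, $R^+(X)=\{s:\exists w\,(Rws\wedge w\in X)\}$, $R(X)=R^-(X)\cup R^+(X)$. The ultrafilter extension is $\mathfrak{F}^{\mathfrak{ue}}=\langle\mathrm{Uf}(W),R^{\mathfrak{ue}}\rangle$, with $\mathrm{Uf}(W)$ the set of ultrafilters over $W$ and $R^{\mathfrak{ue}}uv$ iff $R^-(X)\in u$ for every $X\in v$. In any directed graph $\langle V,S\rangle$ and $x\in V$, define $\langle x\rangle^0=\{x\}$ and $\langle x\rangle^{i+1}=S(\langle x\rangle^i)\cup\langle x\rangle^i$ (with $S(\cdot)$ defined as $R(\cdot)$ above); the $n$-Hull of $x$ is the induced substructure $\langle\langle x\rangle^n,S\restriction\langle x\rangle^n\rangle$. For $x$ in one graph and $y$ in another, $\langle x\rangle^n\cong\langle y\rangle^n$ means there is an isomorphism between the $n$-Hulls sending $x$ to $y$. *)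

(* Defs.v *)
From mathcomp Require Import all_boot.
From mathcomp Require Import boolp classical_sets functions cardinality filter.

Set Implicit Arguments.
Unset Strict Implicit.
Unset Printing Implicit Defensive.

Local Open Scope classical_set_scope.
Local Open Scope card_scope.

Record digraph := Digraph {
  vertex :> Type;
  edge : vertex -> vertex -> Prop
}.
Arguments edge : clear implicits.

(* R^-(X), R^+(X) and R(X) *)
Definition pre (G : digraph) (X : set G) : set G :=
  [set w | exists s, edge G w s /\ X s].

Definition post (G : digraph) (X : set G) : set G :=
  [set s | exists w, edge G w s /\ X w].

Definition nbr (G : digraph) (X : set G) : set G := pre X `|` post X.

(* `A #= `I_a` says that A is finite with exactly a elements, so that a + b
   below is out-degree plus in-degree (a loop is counted twice). *)
Definition bounded_digraph (G : digraph) : Prop :=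
  exists m : nat, forall w : G, exists a b : nat,
    [/\ [set s | edge G w s] #= `I_a,
        [set s | edge G s w] #= `I_b
      & a + b <= m].

Definition Uf (W : Type) : Type := {u : set_system W | UltraFilter u}.

Definition nonprincipal (W : Type) (u : Uf W) : Prop :=
  ~ exists w : W, sval u = principal_filter w.

Definition ue (G : digraph) : digraph :=
  {| vertex := Uf G;
     edge := fun u v => forall X : set G, sval v X -> sval u (pre X) |}.

(* The set <x>^n. *)
Fixpoint hull_set (G : digraph) (x : G) (n : nat) : set G :=
  if n is i.+1 then nbr (hull_set x i) `|` hull_set x i else [set x].

Lemma hull_set_center (G : digraph) (x : G) (n : nat) : hull_set x n x.
Proof. by elim: n => [|n IHn] //=; right. Qed.

Definition induced (G : digraph) (A : set G) : digraph :=
  {| vertex := {y : G | A y};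
     edge := fun a b => edge G (sval a) (sval b) |}.

Definition hull (G : digraph) (n : nat) (x : G) : digraph := induced (hull_set x n).

Definition hull_root (G : digraph) (n : nat) (x : G) : hull n x :=
  exist (hull_set x n) x (hull_set_center x n).

Definition is_isomorphism (G H : digraph) (f : G -> H) : Prop :=
  bijective f /\ forall a b : G, edge G a b <-> edge H (f a) (f b).

(* <x>^n \cong <y>^n *)
Definition hull_iso (G H : digraph) (n : nat) (x : G) (y : H) : Prop :=
  exists f : hull n x -> hull n y,
    is_isomorphism f /\ f (hull_root n x) = hull_root n y.
Arguments hull_iso : clear implicits.

(* Main.v *)
Require Import Defs.
From mathcomp Require Import all_boot.
From mathcomp Require Import boolp classical_sets functions cardinality filter.

Set Implicit Arguments.
Unset Strict Implicit.
Unset Printing Implicit Defensive.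

Local Open Scope classical_set_scope.

(** Boundedness gives finitely many maps [f_i : W -> W] such that the vertices
    equal or adjacent to [x] are exactly the [f_i x].  Pushing ultrafilters
    forward, the vertices of the ultrafilter extension equal or adjacent to [v]
    are exactly the [f_i v].  Hence both n-hulls consist of the values of the
    words [s] of length [n] in the [f_i], at [w] and at [u] respectively, and it
    suffices that for [u]-almost all [w] the map [s w |-> s u] respects and
    reflects equality and edges.  The key point is that [s u = t u] implies
    [s w = t w] for [u]-almost all [w].  Walking back along paths, and since
    there are finitely many words of each length, some word [r] satisfies
    [r (s w) = w] for [u]-almost all [w].  Then the map [t r] fixes the
    ultrafilter [s u], so by Katětov's theorem it fixes [s u]-almost every
    point, that is, [t w = t (r (s w)) = s w] for [u]-almost all [w]. *)

Section Ultrafilters.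

Variables (T : Type) (F : set_system T).
Context {FU : UltraFilter F}.

Lemma ultra_setC (A : set T) : ~ F A -> F (~` A).
Proof. by have [] := in_ultra_setVsetC A FU. Qed.

Lemma ultra_iff (A : set T) (Q : Prop) :
  (F A <-> Q) -> F [set x | A x <-> Q].
Proof.
move=> FAQ; have [q|nq] := pselect Q; first by apply: filterS (FAQ.2 q).
have /ultra_setC : ~ F A by move=> /FAQ.
by apply: filterS => x nAx; split.
Qed.

Lemma ultra_cover (I : finType) (D : set T) (P : I -> set T) :
  F D -> (forall x, D x -> exists i, P i x) -> exists i, F (P i).
Proof.
move=> FD cov; apply: contrapT => /forallNP nP.
have F_nP : F [set x | forall i, ~ P i x].
  by apply: filter_forall => i; apply: ultra_setC.
by have [x [/cov [i Pix] /(_ i)]] := filter_ex (filterI FD F_nP).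
Qed.

End Ultrafilters.

Lemma setVsetC_ultra (T : Type) (F : set_system T) :
  ProperFilter F -> (forall A, F A \/ F (~` A)) -> UltraFilter F.
Proof.
move=> FP dec; split=> // G GP FG; apply/seteqP; split=> // A GA.
have [//|/FG GC] := dec A.
by exfalso; apply: (filter_not_empty G); rewrite -(setICr A); apply: filterI.
Qed.

Lemma fmap_ultra (T U : Type) (f : T -> U) (F : set_system T) :
  UltraFilter F -> UltraFilter (fmap f F).
Proof.
move=> FU; apply: setVsetC_ultra => A.
exact: (in_ultra_setVsetC (f @^-1` A)).
Qed.

#[local] Instance Uf_ultra (W : Type) (u : Uf W) : UltraFilter (sval u) :=
  svalP u.

Lemma Uf_sub_eq (W : Type) (u v : Uf W) : sval u `<=` sval v -> u = v.
Proof.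
case: u v => [u uU] [v vU] /= uv; apply: eq_exist.
by rewrite (max_filter (@ultra_proper _ _ vU) uv).
Qed.

Definition push (W V : Type) (f : W -> V) (u : Uf W) : Uf V :=
  exist _ (fmap f (sval u)) (fmap_ultra f (svalP u)).

Lemma push_id (W : Type) (u : Uf W) : push id u = u.
Proof. exact: Uf_sub_eq. Qed.

Lemma push_comp (W V U : Type) (f : V -> U) (g : W -> V) (u : Uf W) :
  push f (push g u) = push (f \o g) u.
Proof. exact: Uf_sub_eq. Qed.

Lemma near_eq_push (W V : Type) (f g : W -> V) (u : Uf W) :
  sval u [set w | f w = g w] -> push f u = push g u.
Proof.
by move=> fg; apply: Uf_sub_eq => X /=; apply: filterS2 fg => w /= ->.
Qed.

Lemma ex_least_nat_fun (T : Type) (P : T -> nat -> Prop) :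
  exists d : T -> nat, forall x n, P x n -> P x (d x) /\ d x <= n.
Proof.
suff /choice [d dP] (x : T) : exists m, forall n, P x n -> P x m /\ m <= n.
  by exists d.
have [[n Pn]|nP] := pselect (exists n, P x n); last first.
  by exists 0 => n Pn; case: nP; exists n.
have exPx : exists m, `[< P x m >] by exists n; apply/asboolP.
case: (ex_minnP exPx) => m /asboolP Pm m_min; exists m => k Pk.
by split=> //; apply/m_min/asboolP.
Qed.

Lemma eventually_periodic (T : Type) (f : T -> T) (z : T) (k m : nat) :
  k <= m -> iter m.+1 f z = iter k f z ->
  forall n, exists2 j, j <= m & iter n f z = iter j f z.
Proof.
elim/Pchoice: T => T in f z * => km e n.
have /loopingP /(_ n) /trajectP [j jm jE] : looping f z m.+1.
  by rewrite /looping e; apply/trajectP; exists k.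
by exists j.
Qed.

Section FixedUltrafilter.

Variables (W : Type) (f : W -> W) (u : Uf W).
Hypothesis push_f : push f u = u.

Lemma push_fixed_preimage (A : set W) : sval u A -> sval u (f @^-1` A).
Proof. by rewrite -[in sval u A]push_f. Qed.

Lemma push_fixed_not_flip (b : W -> bool) : ~ sval u [set x | b (f x) = ~~ b x].
Proof.
move=> flip; have [x _|k uk] :=
  @ultra_cover _ (sval u) _ _ setT (fun k => [set x | b x = k]) filterT.
  by exists (b x).
have [x [/= flip_x [bx bfx]]] :=
  filter_ex (filterI flip (filterI uk (push_fixed_preimage uk))).
by move: flip_x; rewrite bfx bx; case: (k).
Qed.

Lemma push_fixed_recurrent (A : set W) :
  (forall x, exists n, A (iter n f x)) -> sval u A.
Proof.
move=> hitA; have [d dP] := ex_least_nat_fun (fun x n => A (iter n f x)).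
apply: contrapT => /ultra_setC uC.
apply: (@push_fixed_not_flip (odd \o d)); apply: filterS uC => x /= nAx.
suff -> : d x = (d (f x)).+1 by rewrite /= negbK.
have [n /dP [Afd _]] := hitA (f x); rewrite -iterSr in Afd.
have [Ad d_le] := dP _ _ Afd.
case: (d x) Ad d_le => [//|m]; rewrite iterSr ltnS => /dP [_ fd_le] m_le.
by apply/eqP; rewrite eqSS eqn_leq m_le.
Qed.

End FixedUltrafilter.

Definition orbits_meet (W : Type) (f : W -> W) (x y : W) : Prop :=
  exists m n, iter m f x = iter n f y.

Lemma orbits_meet_step (W : Type) (f : W -> W) (x : W) :
  orbits_meet f (f x) = orbits_meet f x.
Proof.
apply/funext => y; apply/propext; split=> -[m [n e]].
  by exists m.+1, n; rewrite iterSr.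
by exists m, n.+1; rewrite -iterSr !iterS e.
Qed.

Lemma ex_orbit_root (W : Type) (f : W -> W) :
  exists2 c : W -> W, forall x, orbits_meet f x (c x) & forall x, c (f x) = c x.
Proof.
elim/Ppointed: W => W in f *; first by exists id => x; have := no x.
exists (fun x => get (orbits_meet f x)) => x; last by rewrite orbits_meet_step.
by apply: (@getI _ (orbits_meet f x) x); exists 0, 0.
Qed.

Section OrbitPosition.

Variables (W : Type) (f : W -> W) (c : W -> W) (e : W -> nat).
Hypothesis c_f : forall x, c (f x) = c x.
Hypothesis e_least : forall x n,
  x = iter n f (c x) -> x = iter (e x) f (c x) /\ e x <= n.

Definition on_root_orbit : set W := [set x | x = iter (e x) f (c x)].

Lemma on_root_orbit_step (x : W) :
  on_root_orbit x -> on_root_orbit (f x) /\ e (f x) <= (e x).+1.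
Proof. by move=> xE; apply: e_least; rewrite c_f /= -xE. Qed.

Lemma stalled_position_max (x y : W) :
  on_root_orbit x -> e (f x) <= e x -> on_root_orbit y -> c y = c x ->
  e y <= e x.
Proof.
move=> xE e_fx yE cy; have [fxE _] := on_root_orbit_step xE.
have cycle : iter (e x).+1 f (c x) = iter (e (f x)) f (c x).
  by rewrite -[c x in RHS]c_f -fxE /= -xE.
have [j j_le yj] := eventually_periodic e_fx cycle (e y).
rewrite -cy -yE in yj; have [_ y_le] := e_least yj.
exact: leq_trans j_le.
Qed.

Lemma stalled_twice_fixed (x : W) :
  on_root_orbit x -> e (f x) <= e x -> e (f (f x)) <= e (f x) -> f x = x.
Proof.
move=> xE e_fx e_ffx; have [fxE _] := on_root_orbit_step xE.
have e_eq : e (f x) = e x.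
  by apply/anti_leq/andP; split; apply: stalled_position_max.
by rewrite fxE c_f e_eq -xE.
Qed.

End OrbitPosition.

(* Katětov's theorem.  By recurrence, almost every [x] lies on the forward orbit
   of the root [c x] of its component; let [e x] be its position there.  If the
   position almost always increased by one, its parity would flip; and if two
   consecutive points both fail to increase it, they are equal. *)
Lemma push_fixed_near_id (W : Type) (f : W -> W) (u : Uf W) :
  push f u = u -> sval u [set x | f x = x].
Proof.
move=> push_f; have [c c_meet c_f] := ex_orbit_root f.
have c_iter n x : c (iter n f x) = c x by elim: n => //= n <-.
have [e e_least] := ex_least_nat_fun (fun x n => x = iter n f (c x)).
have u_orbit : sval u (on_root_orbit f c e).
  apply: (push_fixed_recurrent push_f) => x; have [m [n xE]] := c_meet x.
  by exists m; apply: (e_least _ n _).1; rewrite c_iter.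
pose stalled := [set x | e (f x) <= e x].
have [u_stalled|/ultra_setC u_moving] := pselect (sval u stalled).
  apply: filterS3 u_orbit u_stalled (push_fixed_preimage push_f u_stalled) => x.
  exact: stalled_twice_fixed.
exfalso; apply: (push_fixed_not_flip push_f (b := odd \o e)).
apply: filterS2 u_orbit u_moving => x x_orbit /negP; rewrite -ltnNge /= => e_lt.
have [_ e_le] := on_root_orbit_step c_f e_least x_orbit.
suff -> : e (f x) = (e x).+1 by [].
by apply/eqP; rewrite eqn_leq e_le.
Qed.

Lemma push_eq_near (W V : Type) (f g : W -> V) (h : V -> W) (u : Uf W) :
  sval u [set w | h (f w) = w] -> push f u = push g u ->
  sval u [set w | f w = g w].
Proof.
move=> hfK fg; have hf : push h (push f u) = u.
  by rewrite push_comp (near_eq_push hfK) push_id.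
have /push_fixed_near_id gh : push (g \o h) (push f u) = push f u.
  by rewrite -push_comp hf fg.
have {}gh : sval u [set w | g (h (f w)) = f w] by [].
by apply: filterS2 hfK gh => w /= ->.
Qed.

Lemma ue_edge_post (G : digraph) (u v : Uf G) (X : set G) :
  edge (ue G) u v -> sval u X -> sval v (post X).
Proof.
move=> uv uX; apply: contrapT => /ultra_setC /uv v_pre.
have [w [Xw [s [ws nXs]]]] := filter_ex (filterI uX v_pre).
by apply: nXs; exists w.
Qed.

Lemma ue_edge_push (G : digraph) (W : Type) (s t : W -> G) (u : Uf W) :
  sval u [set w | edge G (s w) (t w)] -> edge (ue G) (push s u) (push t u).
Proof. by move=> st X tX; apply: filterS2 st tX => w /= e Xt; exists (t w). Qed.

Lemma ue_edge_ex_push (G : digraph) (I : finType) (f : I -> G -> G)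
    (u v : Uf G) :
  (forall x y, edge G x y -> exists i, y = f i x) ->
  edge (ue G) u v ->
  exists2 i, v = push (f i) u & sval u [set x | edge G x (f i x)].
Proof.
move=> f_cover uv.
suff [i iP] : exists i, forall X, sval v X ->
    sval u [set x | edge G x (f i x) /\ X (f i x)].
  exists i; last by apply: filterS (iP _ filterT) => x [].
  by apply: Uf_sub_eq => X /iP; apply: filterS => x [].
apply: contrapT => /forallNP no_index.
have /choice [X XP] i : exists X, sval v X /\
    ~ sval u [set x | edge G x (f i x) /\ X (f i x)].
  by have /existsNP [X /not_implyP] := no_index i; exists X.
have vX : sval v [set x | forall i, X i x].
  by apply: filter_forall => i; apply: (XP i).1.
have [x [y [xy Xy]]|i] := @ultra_cover _ _ _ _ _
    (fun i => [set x | edge G x (f i x) /\ X i (f i x)]) (uv _ vX).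
  by have [i yE] := f_cover _ _ xy; exists i; rewrite /= -yE.
exact: (XP i).2.
Qed.

Definition adj_or_eq (G : digraph) (x y : G) : Prop :=
  x = y \/ (edge G x y \/ edge G y x).

Lemma adj_or_eq_sym (G : digraph) (x y : G) : adj_or_eq x y -> adj_or_eq y x.
Proof. by move=> [->|[]]; [left|right; right|right; left]. Qed.

Definition adj_graph (G : digraph) : digraph := Digraph (@adj_or_eq G).

Lemma ue_adj_graphE (G : digraph) (u v : Uf G) :
  edge (ue (adj_graph G)) u v <-> adj_or_eq (G := ue G) u v.
Proof.
split=> [uv|[<-|[uv|vu]] X vX].
- apply: contrapT => /not_orP [uv_neq /not_orP [nuv nvu]].
  have [X vX uCX] : exists2 X, sval v X & ~ sval u X.
    apply: contrapT => /forall2NP nX; apply/uv_neq/esym/Uf_sub_eq => X vX.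
    by have [|/contrapT] := nX X.
  have /existsNP [Y /not_implyP [vY upre]] := nuv.
  have /existsNP [Z /not_implyP [uZ vpre]] := nvu.
  move: uCX upre vpre => /ultra_setC uCX /ultra_setC upre /ultra_setC vpre.
  have /uv uXYZ : sval v (X `&` Y `&` ~` pre Z).
    by apply: filterI => //; apply: filterI.
  have [x [[Zx nXx] [nYx [y [xy [[Xy Yy] nZy]]]]]] :=
    filter_ex (filterI (filterI uZ uCX) (filterI upre uXYZ)).
  case: xy => [xy|[xy|yx]].
  + by apply: nXx; rewrite xy.
  + by apply: nYx; exists y.
  + by apply: nZy; exists x.
- by apply: filterS vX => x Xx; exists x; split=> //; left.
- apply: filterS (uv _ vX) => x [y [xy Xy]].
  by exists y; split=> //; right; left.
- apply: filterS (ue_edge_post vu vX) => x [y [yx Xy]].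
  by exists y; split=> //; right; right.
Qed.

Lemma hull_setS (G : digraph) (x y : G) (n : nat) :
  hull_set x n.+1 y <-> exists2 z, hull_set x n z & adj_or_eq z y.
Proof.
split=> [[[[z [yz h]]|[z [zy h]]]|h]|[z h [<-|[zy|yz]]]] /=.
- by exists z => //; right; right.
- by exists z => //; right; left.
- by exists y => //; left.
- by right.
- by left; right; exists z.
- by left; left; exists z.
Qed.

Definition adj_enum (G : digraph) (I : Type) (f : I -> G -> G) : Prop :=
  forall x y, adj_or_eq x y <-> exists i, y = f i x.

Lemma card_eq_ord_cover (T : Type) (A : set T) (n m : nat) (x0 : T) :
  (A #= `I_n)%card -> n <= m ->
  exists c : 'I_m -> T, forall y, A y -> exists i, y = c i.
Proof.
elim/Ppointed: T => T in A x0 *; first by case: (no x0).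
rewrite card_eq_le => /andP [/pcard_surjP [c cP] _] nm.
exists (fun i => c i) => y /cP [i ltin <-].
by exists (Ordinal (leq_trans ltin nm)).
Qed.

Lemma bounded_adj_enum (G : digraph) : bounded_digraph G ->
  exists (I : finType) (f : I -> G -> G), adj_enum f.
Proof.
move=> [m G_bounded]; pose I : finType := option ('I_m + 'I_m)%type; exists I.
have /choice [c cP] (x : G) : exists c : I -> G,
    forall y, adj_or_eq x y -> exists i, y = c i.
  have [a [b [card_out card_in abm]]] := G_bounded x.
  have [c cP] := card_eq_ord_cover x card_out (leq_trans (leq_addr _ _) abm).
  have [d dP] := card_eq_ord_cover x card_in (leq_trans (leq_addl _ _) abm).
  exists (oapp (fun i => match i with inl j => c j | inr j => d j end) x).
  move=> y [<-|[/cP [i ->]|/dP [i ->]]].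
  - by exists None.
  - by exists (Some (inl i)).
  - by exists (Some (inr i)).
exists (fun i x => if `[< adj_or_eq x (c x i) >] then c x i else x) => x y.
split=> [xy|[i ->]]; last by case: asboolP => // _; left.
by have [i yE] := cP x y xy; exists i; rewrite -yE asboolT.
Qed.

Definition word_act (W I : Type) (f : I -> W -> W) (s : seq I) (x : W) : W :=
  foldr f x s.

Lemma word_act_push (W I : Type) (f : I -> W -> W) (s : seq I) (u : Uf W) :
  word_act (fun i => push (f i)) s u = push (word_act f s) u.
Proof. by elim: s => [|i s /= ->]; rewrite ?push_id // push_comp. Qed.

Lemma hull_set_word (G : digraph) (I : Type) (f : I -> G -> G) (n : nat)
    (x y : G) : adj_enum f ->
  hull_set x n y <-> exists s : n.-tuple I, y = word_act f s x.
Proof.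
move=> fP; elim: n y => [|n IHn] y.
  by split=> [->|[s ->]]; [exists [tuple]|rewrite (tuple0 s)].
rewrite hull_setS; split=> [[z /IHn [s ->] /fP [i ->]]|[s ->]].
  by exists [tuple of i :: s].
rewrite (tuple_eta s); exists (word_act f (behead_tuple s) x).
  by apply/IHn; exists (behead_tuple s).
by apply/fP; exists (thead s).
Qed.

Section AdjacencyEnumeration.

Variables (G : digraph) (I : finType) (f : I -> G -> G).
Hypothesis f_enum : adj_enum f.

Lemma word_act_return (s : seq I) (x : G) :
  exists r : (size s).-tuple I, word_act f r (word_act f s x) = x.
Proof.
elim: s => [|i s [r rsK]] /=; first by exists [tuple].
have /adj_or_eq_sym/f_enum [j jE] :
    adj_or_eq (word_act f s x) (f i (word_act f s x)).
  by apply/f_enum; exists i.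
by exists [tuple of rcons r j]; rewrite /word_act /= foldr_rcons -jE.
Qed.

Lemma ue_adj_enum : adj_enum (G := ue G) (fun i => push (f i)).
Proof.
move=> u v; rewrite -ue_adj_graphE; split=> [uv|[i ->]].
  have [x y /f_enum //|i vE _] := @ue_edge_ex_push (adj_graph G) _ f _ _ _ uv.
  by exists i.
rewrite -{1}(push_id u); apply: (@ue_edge_push (adj_graph G)).
by apply: filterS filterT => x _; apply/f_enum; exists i.
Qed.

Lemma ue_hull_set_word (n : nat) (u : Uf G) (v : ue G) :
  hull_set (G := ue G) u n v <->
  exists s : n.-tuple I, v = push (word_act f s) u.
Proof.
rewrite (hull_set_word _ _ _ ue_adj_enum).
by split=> -[s ->]; exists s; rewrite word_act_push.
Qed.

Lemma push_word_eq (u : Uf G) (s t : seq I) :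
  sval u [set w | word_act f s w = word_act f t w] <->
  push (word_act f s) u = push (word_act f t) u.
Proof.
split; first exact: near_eq_push.
have [w _|r rsK] := @ultra_cover _ (sval u) _ _ setT
    (fun r : (size s).-tuple I => [set w | word_act f r (word_act f s w) = w])
    filterT.
  exact: word_act_return.
exact: push_eq_near rsK.
Qed.

Lemma push_word_edge (u : Uf G) (s t : seq I) :
  sval u [set w | edge G (word_act f s w) (word_act f t w)] <->
  edge (ue G) (push (word_act f s) u) (push (word_act f t) u).
Proof.
split=> [|st]; first exact: ue_edge_push.
have [x y xy|i tE edge_i] := @ue_edge_ex_push _ _ f _ _ _ st.
  by apply/f_enum; right; left.
rewrite push_comp -[f i \o _]/(word_act f (i :: s)) in tE.
have {}edge_i :
  sval u [set w | edge G (word_act f s w) (word_act f (i :: s) w)] by [].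
by apply: filterS2 edge_i ((push_word_eq _ _ _).2 tE) => w /= e ->.
Qed.

End AdjacencyEnumeration.

Lemma ex_bijective_of_same_fibers (I T U : Type) (p : I -> T) (q : I -> U) :
  (forall x, exists i, p i = x) -> (forall y, exists i, q i = y) ->
  (forall i j, p i = p j <-> q i = q j) ->
  exists2 f : T -> U, bijective f & forall i, f (p i) = q i.
Proof.
move=> /choice [a aK] /choice [b bK] pq.
exists (q \o a) => [|i]; last by apply/pq; rewrite aK.
exists (p \o b) => z /=.
  by rewrite -[RHS]aK; apply/pq; rewrite bK.
by rewrite -[RHS]bK; apply/pq; rewrite aK.
Qed.

Lemma sval_inj (T : Type) (A : set T) : injective (@sval T A).
Proof. by move=> [x Ax] [y Ay]; apply: eq_exist. Qed.

Lemma ex_sig_enum (T I : Type) (A : set T) (p : I -> T) :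
  (forall z, A z <-> exists i, z = p i) ->
  exists2 p' : I -> {z | A z}, forall i, sval (p' i) = p i &
    forall z, exists i, p' i = z.
Proof.
move=> pP; have Ap i : A (p i) by apply/pP; exists i.
exists (fun i => exist A (p i) (Ap i)) => // -[z Az].
by have [i zE] := (pP z).1 Az; exists i; apply: eq_exist.
Qed.

Lemma hull_iso_of_enum (G H : digraph) (I : Type) (n : nat) (x : G) (y : H)
    (p : I -> G) (q : I -> H) :
  (forall z, hull_set x n z <-> exists i, z = p i) ->
  (forall z, hull_set y n z <-> exists i, z = q i) ->
  (forall i j, p i = p j <-> q i = q j) ->
  (forall i j, edge G (p i) (p j) <-> edge H (q i) (q j)) ->
  (exists2 i, x = p i & y = q i) ->
  hull_iso G H n x y.
Proof.
move=> /ex_sig_enum [p' p'E p'_surj] /ex_sig_enum [q' q'E q'_surj].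
move=> pq_eq pq_edge [r xr yr].
have pq'_eq i j : p' i = p' j <-> q' i = q' j.
  by split=> /(congr1 sval); rewrite ?p'E ?q'E => /pq_eq ?; apply: sval_inj;
    rewrite ?p'E ?q'E.
have [g g_bij gE] := ex_bijective_of_same_fibers p'_surj q'_surj pq'_eq.
exists g; split; last first.
  have -> : hull_root n x = p' r by apply: sval_inj; rewrite p'E.
  by rewrite gE; apply: sval_inj; rewrite q'E.
split=> // a b; have [[i <-] [j <-]] := (p'_surj a, p'_surj b).
by rewrite !gE /= !p'E !q'E; apply: pq_edge.
Qed.

Theorem theorem4p4 (F : digraph) (F_bounded : bounded_digraph F)
    (n : nat) (u : Uf F) (u_nonprincipal : nonprincipal u) :
  sval u [set w : F | hull_iso F (ue F) n w u].
Proof.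
have [I [f f_enum]] := bounded_adj_enum F_bounded.
have near_eq : sval u [set w | forall s t : n.-tuple I,
    word_act f s w = word_act f t w <->
    push (word_act f s) u = push (word_act f t) u].
  by do 2!apply: filter_forall => ?; apply: ultra_iff; apply: push_word_eq.
have near_edge : sval u [set w | forall s t : n.-tuple I,
    edge F (word_act f s w) (word_act f t w) <->
    edge (ue F) (push (word_act f s) u) (push (word_act f t) u)].
  by do 2!apply: filter_forall => ?; apply: ultra_iff; apply: push_word_edge.
have u_hull := ue_hull_set_word f_enum n u.
have [r ur] := (u_hull u).1 (hull_set_center (G := ue F) u n).
have near_root : sval u [set w | word_act f [::] w = word_act f r w].
  by apply/push_word_eq => //; rewrite -ur push_id.
apply: filterS3 near_eq near_edge near_root => w w_eq w_edge w_root.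
apply: (hull_iso_of_enum _ u_hull w_eq w_edge); last by exists r.
by move=> z; apply: hull_set_word.
Qed.
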